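(* Let $p,q$ be positive integers with $\gcd(p,q)=1$, and let $K=\{(e^{ip\theta},e^{-iq\theta}):\ 0\le\theta\le 2\pi\}\subset\mathbb{C}^2$ be the $(p,-q)$-torus knot. Then every polynomial $P(z,w)$ with complex coefficients satisfying $P(0,0)=1$ and $\|P\|_K<1$ has degree at least $p+q$. Furthermore, $\mathcal{P}_{p+q}(K)=K$, and for every $d\in\mathbb{N}$ with $d<p+q$, the hull $\mathcal{P}_d(K)$ strictly contains $K$.
   Context: For a compact set $K\subset\mathbb{C}^n$ and a polynomial $P$ on $\mathbb{C}^n$ with complex coefficients, $\|P\|_K=\sup_{z\in K}|P(z)|$. For $d\in\mathbb{N}$, the $d$-polynomial hull of $K$ is $\mathcal{P}_d(K)=\{z\in\mathbb{C}^n:\ |P(z)|\le\|P\|_K\text{ for all polynomials }P\text{ with }\deg P\le d\}$, where $\deg$ is the total degree. *)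

(* Defs.v *)
(* Libraries: MathComp, with R[i] (over an arbitrary R : realType) from
   real-closed as the complex numbers, and MathComp-Analysis. *)
From mathcomp Require Import all_boot all_order all_algebra.
From mathcomp Require Import complex classical_sets reals trigo.
(* The notations of mpoly clash with parts of MathComp-Analysis and are left out:
   [mpoly n R] is {mpoly R[n]} and [meval v P] is P.@[v]. *)
From mathcomp Require Import -(notations) mpoly.

Set Implicit Arguments.
Unset Strict Implicit.
Unset Printing Implicit Defensive.

Local Open Scope classical_set_scope.
Local Open Scope complex_scope.
Local Open Scope ring_scope.

(* Points of C^n are row vectors, and [z 0] is the coordinate function of z. *)
Definition peval (R : realType) (n : nat)
    (P : mpoly n R[i]) (z : 'rV[R[i]]_n) : R[i] :=
  meval (z 0) P.

(* Total degree: msize is 1 + the degree for a nonzero polynomial and 0 for the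
   zero polynomial, to which this assigns degree 0. *)
Definition total_degree (R : realType) (n : nat)
    (P : mpoly n R[i]) : nat :=
  (mpoly.msize P).-1.

(* Normc.normc is the R-valued modulus (the norm `|_| of R[i] is R[i]-valued).
   The supremum is the intended one when K is nonempty and P is bounded on K,
   e.g. for K nonempty compact; sup is 0 on the empty set. *)
Definition sup_norm (R : realType) (n : nat)
    (K : set 'rV[R[i]]_n) (P : mpoly n R[i]) : R :=
  sup [set Normc.normc (peval P z) | z in K].

Definition poly_hull (R : realType) (n d : nat)
    (K : set 'rV[R[i]]_n) : set 'rV[R[i]]_n :=
  [set z | forall P : mpoly n R[i], (total_degree P <= d)%N ->
             Normc.normc (peval P z) <= sup_norm K P].

Definition expi (R : realType) (t : R) : R[i] := cos t +i* sin t.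

Definition cpair (R : realType) (z w : R[i]) : 'rV[R[i]]_2 :=
  \row_(j < 2) (if j == 0 then z else w).

Definition torus_knot (R : realType) (p q : nat) : set 'rV[R[i]]_2 :=
  [set cpair (expi (p%:R * t)) (expi (- (q%:R * t)))
     | t in [set t : R | 0 <= t <= 2 * pi]].
Arguments torus_knot : clear implicits.

(* Main.v *)
(* On K one has z^q w^p = 1, and since gcd(p,q) = 1 the only monomials z^a w^b
   that are constant on K are the powers of z^q w^p.  Hence a polynomial of
   degree less than p + q has mean value P(0,0) on K, and (0,0) lies in the
   d-hull for d < p + q.  The mean is taken over the N-th roots of unity for a
   large N instead of the circle.  Conversely z, w and 1 - z^q w^p have degree
   at most p + q, and the bounds |z| <= 1, |w| <= 1, z^q w^p = 1 that they give
   on the hull define K, by a Bezout relation between p and q. *)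
Require Import Defs.
From mathcomp Require Import all_boot all_order all_algebra.
From mathcomp Require Import complex classical_sets reals trigo.
From mathcomp Require Import -(notations) mpoly.
From mathcomp Require Import ring lra zify.

Set Implicit Arguments.
Unset Strict Implicit.
Unset Printing Implicit Defensive.

Import Order.TTheory GRing.Theory Num.Theory.

Local Open Scope classical_set_scope.
Local Open Scope ring_scope.

(** * The modulus on [R[i]] *)

Lemma normcX (R : rcfType) (x : R[i]) (n : nat) :
  Normc.normc (x ^+ n) = Normc.normc x ^+ n.
Proof.
elim: n => [|n IHn]; first by rewrite !expr0 Normc.normc1.
by rewrite !exprS Normc.normcM IHn.
Qed.

Lemma normc_ge0 (R : rcfType) (x : R[i]) : 0 <= Normc.normc x.
Proof. by case: x => a b; exact: sqrtr_ge0. Qed.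

Lemma normc1_neq0 (R : rcfType) (x : R[i]) : Normc.normc x = 1 -> x != 0.
Proof.
by apply: contra_eq_neq => ->; rewrite Normc.normc0 eq_sym oner_eq0.
Qed.

Lemma normc_sum_le (R : rcfType) (I : Type) (r : seq I) (F : I -> R[i]) :
  Normc.normc (\sum_(i <- r) F i) <= \sum_(i <- r) Normc.normc (F i).
Proof.
elim/big_rec2: _ => [|i x y _ IH]; first by rewrite Normc.normc0.
exact: le_trans (le_normcD _ _) (lerD (lexx _) IH).
Qed.

(** * The unit circle and its roots of unity *)

Section Expi.
Variable R : realType.
Implicit Types t : R.

Lemma expi0 : expi (0 : R) = 1.
Proof. by rewrite /expi cos0 sin0. Qed.

Lemma expiD t u : expi (t + u) = expi t * expi u.
Proof.
by apply/eqP; rewrite eq_complex /= cosD sinD eqxx /= addrC mulrC eqxx.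
Qed.

Lemma expiX t n : expi (n%:R * t) = expi t ^+ n.
Proof.
elim: n => [|n IHn]; first by rewrite mul0r expi0.
by rewrite -natr1 mulrDl mul1r expiD IHn exprSr.
Qed.

Lemma expi_neq0 t : expi t != 0.
Proof.
by apply: contraTneq (oner_neq0 R[i]) => t0;
  rewrite -expi0 -(subrr t) expiD t0 mul0r eqxx.
Qed.

Lemma expiN t : expi (- t) = (expi t)^-1.
Proof.
by apply: (mulfI (expi_neq0 t)); rewrite -expiD subrr expi0 divff ?expi_neq0.
Qed.

Lemma normc_expi t : Normc.normc (expi t) = 1.
Proof. by rewrite /= cos2Dsin2 sqrtr1. Qed.

(** The angle [acos a] has the right cosine and a nonnegative sine; when [b] is negative, its
    reflection [2 * pi - acos a] is taken instead. *)
Lemma expi_surj (x : R[i]) :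
  Normc.normc x = 1 -> exists2 t, 0 <= t <= 2 * pi & expi t = x.
Proof.
case: x => a b /= ab1.
have {}ab1 : a ^+ 2 + b ^+ 2 = 1.
  by rewrite -[LHS]sqr_sqrtr ?ab1 ?expr1n // addr_ge0 ?sqr_ge0.
have aB : -1 <= a <= 1 by have := sqr_ge0 b; nra.
have a_itv : a \in `[(-1), 1] by rewrite in_itv.
have := acos_ge0 aB; have := acos_lepi aB => acosL acosG.
have sinE : sin (acos a) = `|b|.
  by rewrite sin_acos // -sqrtr_sqr -ab1 [a ^+ 2 + _]addrC addrK.
have pi0 := pi_ge0 R.
have [b0|b0] := leP 0 b.
  exists (acos a); first by apply/andP; split=> //; lra.
  by rewrite /expi acosK // sinE ger0_norm.
exists (- acos a + pi *+ 2); first by apply/andP; split; rewrite mulr2n; lra.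
by rewrite /expi cosD2pi sinD2pi cosN sinN acosK // sinE ltr0_norm // opprK.
Qed.

Lemma expi_prim_root n :
  (0 < n)%N -> n.-primitive_root (expi (2 * pi / n%:R : R)).
Proof.
move=> n0; have nR0 : (0 : R) < n%:R by rewrite ltr0n.
have w1 : expi (2 * pi / n%:R : R) ^+ n = 1.
  rewrite -expiX mulrC divfK ?gt_eqF // mulr_natl.
  by rewrite /expi cos2pi sin2pi.
apply/andP; split=> //; apply/forallP => -[i /= i_lt]; rewrite unity_rootE.
have [->|i_neq] := eqVneq i.+1 n; first by rewrite w1 eqxx.
have {i_neq}i_lt : (i.+1 < n)%N by rewrite ltn_neqAle i_neq.
(* The half angle [y] lies strictly between [0] and [pi], so the real part
   [cos (y + y) = 1 - 2 sin(y)^2] is less than 1. *)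
rewrite eqbF_neg -expiX; pose y : R := i.+1%:R * pi / n%:R.
have -> : i.+1%:R * (2 * pi / n%:R) = y + y by rewrite /y; ring.
have sin_y : 0 < sin y.
  apply: sin_gt0_pi; rewrite /y divr_gt0 ?mulr_gt0 ?pi_gt0 ?ltr0n //=.
  by rewrite ltr_pdivrMr // mulrC ltr_pM2l ?pi_gt0 // ltr_nat.
apply/negP => /eqP /(congr1 (@complex.Re R)) /=.
have := cos2Dsin2 y; rewrite cosD; nra.
Qed.
End Expi.

(** * Polynomials in two variables on the knot *)

Section TorusKnot.
Variable R : realType.
Implicit Types (P : mpoly 2 R[i]) (x z w : R[i]) (p q d : nat).

Lemma pevalE P z w :
  peval P (cpair z w) =
  \sum_(m <- msupp P) mcoeff m P * (z ^+ m ord0 * w ^+ m ord_max).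
Proof.
rewrite /peval mevalE; apply: eq_bigr => m _.
rewrite big_ord_recl big_ord1 !mxE /=; congr (_ * (_ * _)).
by congr (_ ^+ m _); apply/val_inj.
Qed.

Lemma mdeg2 (m : multinom 2) : mdeg m = (m ord0 + m ord_max)%N.
Proof.
by rewrite mdegE big_ord_recl big_ord1; congr (_ + m _)%N; apply/val_inj.
Qed.

(** Trading the angle for a unimodular [x] turns the later arguments into pure algebra. *)
Lemma torus_knotP p q (u : 'rV[R[i]]_2) :
  torus_knot R p q u <->
  exists2 x, Normc.normc x = 1 & cpair (x ^+ p) (x ^- q) = u.
Proof.
split=> [[t _ <-]|[x /expi_surj[t t_itv <-] <-]].
  by exists (expi t); rewrite ?normc_expi // expiN !expiX.
by exists t; rewrite // expiN !expiX.
Qed.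

Lemma cpair_inj z w z' w' : cpair z w = cpair z' w' -> z = z' /\ w = w'.
Proof.
by move=> /rowP e; have := e ord0; have := e ord_max; rewrite !mxE.
Qed.

Lemma cpair_eta (u : 'rV[R[i]]_2) : u = cpair (u 0 0) (u 0 ord_max).
Proof.
apply/rowP => j; rewrite mxE; case: eqP => [->//|/eqP j0].
by congr (u _ _); apply/val_inj; case: j j0 => -[|[|]].
Qed.

Lemma peval_le_sup_norm p q P (u : 'rV[R[i]]_2) :
  torus_knot R p q u ->
  Normc.normc (peval P u) <= sup_norm (torus_knot R p q) P.
Proof.
move=> Ku; apply: ub_le_sup; last by exists u.
(* The [sup] dominates the values only if they are bounded: monomials have modulus 1 on the knot, so
   the moduli of the coefficients add up to a bound. *)
exists (\sum_(m <- msupp P) Normc.normc (mcoeff m P)).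
move=> _ [v /torus_knotP[x x1 <-] <-].
rewrite pevalE; apply: (le_trans (normc_sum_le _ _)); apply: ler_sum => m _.
rewrite !Normc.normcM !normcX Normc.normcV !normcX x1.
by rewrite !expr1n invr1 expr1n !mulr1.
Qed.

Lemma sup_norm_le p q P (M : R) :
  (forall u, torus_knot R p q u -> Normc.normc (peval P u) <= M) ->
  sup_norm (torus_knot R p q) P <= M.
Proof.
move=> PM; apply: ge_sup => [|_ [u Ku <-]]; last exact: PM.
(* The knot must be nonempty here; the parameter [x = 1] gives a point. *)
set u := cpair (1 ^+ p) (1 ^- q : R[i]).
exists (Normc.normc (peval P u)); exists u => //.
by apply/torus_knotP; exists 1; rewrite ?Normc.normc1.
Qed.

(** * Mean values over roots of unity *)

Lemma coprime_mul_eq p q a b :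
  coprime p q -> (0 < p)%N -> (p * a = q * b)%N -> (a + b < p + q)%N ->
  a = 0%N /\ b = 0%N.
Proof.
move=> pq p0 ab lt_ab.
(* With [b = k * p] and [a = k * q], the sum [a + b = k * (p + q)] is below [p + q] only for
   [k = 0]. *)
have /dvdnP[k bE] : (p %| b)%N by rewrite -(Gauss_dvdr b pq) -ab dvdn_mulr.
have aE : a = (k * q)%N.
  by apply/eqP; rewrite -(eqn_pmul2l p0) ab bE; apply/eqP; lia.
by case: k aE bE => [|k] aE bE; [rewrite aE bE | nia].
Qed.

(** By linearity it suffices to treat one monomial, whose values at the sample points form a
    geometric progression. Its sum is 0 unless the ratio is 1, which happens only for the constant
    monomial. *)
Lemma torus_knot_mean p q P (N := ((p + q) * (p + q))%N) x :
  (0 < p)%N -> coprime p q -> (total_degree P < p + q)%N ->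
  N.-primitive_root x ->
  \sum_(j < N) peval P (cpair ((x ^+ j) ^+ p) ((x ^+ j) ^- q)) =
  N%:R * peval P (cpair 0 0).
Proof.
move=> p0 pq degP xN.
have N0 : (0 < N)%N := prim_order_gt0 xN.
have x0 : x != 0.
  apply/eqP => x0; have /eqP := prim_expr_order xN.
  by rewrite x0 expr0n gtn_eqF // eq_sym oner_eq0.
under eq_bigr do rewrite pevalE.
rewrite pevalE exchange_big mulr_sumr /=; apply: eq_big_seq => m mP.
have m_deg : (m ord0 + m ord_max < p + q)%N.
  have := mpoly.msize_mdeg_lt mP; rewrite mdeg2 => m_lt.
  by move: degP m_lt; rewrite /total_degree; lia.
pose r := x ^+ (p * m ord0) / x ^+ (q * m ord_max).
under eq_bigr => j _.
  rewrite (_ : _ * (_ * _) = mcoeff m P * r ^+ j); last first.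
    congr (_ * _); rewrite /r exprMn exprVn exprVn -!exprM; congr (_ * _ ^-1).
      by congr (_ ^+ _); lia.
    by congr (_ ^+ _); lia.
  over.
rewrite -mulr_sumr [RHS]mulrCA; congr (_ * _).
have [rE|rN] := eqVneq (p * m ord0)%N (q * m ord_max)%N.
  have [-> ->] := coprime_mul_eq pq p0 rE m_deg.
  rewrite /r rE divff ?expf_neq0 // !expr0 !mulr1.
  by under eq_bigr do rewrite expr1n; rewrite sumr_const card_ord.
(* This is where the size of [N] matters: both exponents are less than [(p + q)^2], so they differ
   modulo [N] as soon as they differ. *)
have r1 : r != 1.
  rewrite -subr_eq0 /r -[1](@divff _ (x ^+ (q * m ord_max))) ?expf_neq0 //.
  rewrite -mulrBl mulf_neq0 ?invr_eq0 ?expf_neq0 // subr_eq0.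
  rewrite (eq_prim_root_expr xN) !modn_small //; rewrite /N; nia.
have rN1 : r ^+ N = 1.
  rewrite /r exprMn exprVn !(exprAC _ _ N) (prim_expr_order xN).
  by rewrite !expr1n invr1 mulr1.
have /esym/eqP := subrX1 r N; rewrite rN1 subrr mulf_eq0 subr_eq0 (negPf r1) /=.
move=> /eqP ->.
(* The right-hand side must vanish too: a nonconstant monomial is 0 at the origin. *)
have : (m ord0 != 0%N) || (m ord_max != 0%N).
  apply: contraNT rN; rewrite negb_or !negbK => /andP[/eqP -> /eqP ->].
  by rewrite !muln0.
by case/orP => /negPf m0; rewrite !expr0n m0 ?mul0r ?mulr0.
Qed.

(** The triangle inequality applied to the mean value identity. Both the degree bound and the
    strictness of the hulls below [p + q] rest on this estimate. *)
Lemma peval00_le_sup_norm p q P :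
  (0 < p)%N -> coprime p q -> (total_degree P < p + q)%N ->
  Normc.normc (peval P (cpair 0 0)) <= sup_norm (torus_knot R p q) P.
Proof.
move=> p0 pq degP; pose N := ((p + q) * (p + q))%N.
have N0 : (0 < N)%N by rewrite /N; nia.
have xN := @expi_prim_root R N N0.
have /(congr1 (@Normc.normc R)) := torus_knot_mean p0 pq degP xN.
rewrite -/N Normc.normcM => meanE.
have NR : Normc.normc (N%:R : R[i]) = N%:R by rewrite normcMn Normc.normc1.
rewrite -(@ler_pM2l _ N%:R) ?ltr0n // -{1}NR -meanE.
apply: (le_trans (normc_sum_le _ _)).
have sum_cst (y : R) : N%:R * y = \sum_(j < N) y.
  by rewrite sumr_const card_ord mulr_natl.
rewrite sum_cst; apply: ler_sum => j _.
apply: peval_le_sup_norm; apply/torus_knotP.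
by exists (expi (2 * pi / N%:R) ^+ j); rewrite // normcX normc_expi expr1n.
Qed.

(** * Comparison of the hulls with the knot *)

Lemma torus_knot_sub_hull p q d :
  torus_knot R p q `<=` poly_hull d (torus_knot R p q).
Proof. by move=> u Ku P _; exact: peval_le_sup_norm. Qed.

Lemma origin_notin_knot p q : (0 < p)%N -> ~ torus_knot R p q (cpair 0 0).
Proof.
move=> p0 /torus_knotP[x /normc1_neq0 x0 /cpair_inj[/eqP + _]].
by rewrite expf_eq0 (negPf x0) andbF.
Qed.

Lemma torus_knot_unimodular p q z w :
  (0 < p)%N -> coprime p q -> Normc.normc z = 1 -> Normc.normc w = 1 ->
  z ^+ q * w ^+ p = 1 -> torus_knot R p q (cpair z w).
Proof.
move=> p0 pq z1 w1 zw.
have z0 := normc1_neq0 z1.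
have w0 := normc1_neq0 w1.
have [u v uv _] := egcdnP q p0.
move: uv; rewrite (eqP pq) => uv.
(* u p = v q + 1, so for (z, w) = (x^p, x^-q) the parameter is x = z^u w^v *)
have zE : z ^+ q = w ^- p.
  by apply: (mulIf (expf_neq0 p w0)); rewrite zw mulVf ?expf_neq0.
have wE : w ^+ p = z ^- q by rewrite zE invrK.
apply/torus_knotP; exists (z ^+ u * w ^+ v).
  by rewrite Normc.normcM !normcX z1 w1 !expr1n mulr1.
(* Substituting through [zE] and [wE] cancels all but one factor: [x^p] reduces to [z], and [x^q] to
   [w^-1]. *)
congr cpair.
  rewrite exprMn -exprM uv -[(w ^+ v) ^+ p]exprAC wE exprVn -exprM.
  by rewrite exprD expr1 mulrAC mulnC mulfV ?mul1r // expf_neq0.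
apply: invr_inj; rewrite invrK.
rewrite exprMn -[(z ^+ u) ^+ q]exprAC zE exprVn -!exprM.
rewrite [(p * u)%N]mulnC uv addnC exprD expr1 invfM.
by rewrite -mulrA mulVf ?mulr1 // expf_neq0.
Qed.

Lemma hull_in_knot p q :
  (0 < p)%N -> (0 < q)%N -> coprime p q ->
  poly_hull (p + q) (torus_knot R p q) `<=` torus_knot R p q.
Proof.
move=> p0 q0 pq u; rewrite [u]cpair_eta.
move: (u 0 0) (u 0 ord_max) => z w hull.
have z_le1 : Normc.normc z <= 1.
  have /hull : (total_degree (mpolyX R[i] (mnm1 (ord0 : 'I_2))) <= p + q)%N.
    by rewrite /total_degree mmeasureX /= mdeg1; lia.
  rewrite {1}/peval mevalXU mxE /= => /le_trans; apply.
  apply: sup_norm_le => _ /torus_knotP[x x1 <-].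
  by rewrite /peval mevalXU mxE /= normcX x1 expr1n.
have w_le1 : Normc.normc w <= 1.
  have /hull : (total_degree (mpolyX R[i] (mnm1 (ord_max : 'I_2))) <= p + q)%N.
    by rewrite /total_degree mmeasureX /= mdeg1; lia.
  rewrite {1}/peval mevalXU mxE /= => /le_trans; apply.
  apply: sup_norm_le => _ /torus_knotP[x x1 <-].
  by rewrite /peval mevalXU mxE /= Normc.normcV normcX x1 expr1n invr1.
have zw : z ^+ q * w ^+ p = 1.
  pose m : multinom 2 := Multinom [tuple q; p].
  have evalE a b : peval (1 - mpolyX R[i] m) (cpair a b) = 1 - a ^+ q * b ^+ p.
    by rewrite /peval mevalB meval1 mevalX big_ord_recl big_ord1 !mxE.
  have /hull : (total_degree (1 - mpolyX R[i] m)%R <= p + q)%N.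
    (* In terms of [msize], one more than the degree, the bound to reach is [1 + (p + q)]. *)
    rewrite /total_degree -subn1 leq_subLR (leq_trans (mmeasureD_le _ _ _)) //.
    rewrite mmeasureN mmeasure1 mmeasureX geq_max /= mdeg2 /= add1n.
    by rewrite [(q + p)%N]addnC leqnn.
  rewrite evalE => zw_le.
  (* This polynomial vanishes identically on the knot, so its sup norm there is 0. *)
  have : Normc.normc (1 - z ^+ q * w ^+ p) <= 0.
    apply: (le_trans zw_le); apply: sup_norm_le => _ /torus_knotP[x x1 <-].
    have x0 := normc1_neq0 x1.
    rewrite evalE exprVn -!exprM mulnC mulfV ?expf_neq0 //.
    by rewrite subrr Normc.normc0.
  move=> le0; apply/esym/eqP; rewrite -subr_eq0; apply/eqP/Normc.eq0_normc/eqP.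
  by rewrite eq_le le0 normc_ge0.
(* Two factors in [[0, 1]] with product 1 are both 1, and positive exponents pass this on to the
   moduli of [z] and [w]. *)
have nzw : Normc.normc z ^+ q * Normc.normc w ^+ p = 1.
  by rewrite -!normcX -Normc.normcM zw Normc.normc1.
apply: torus_knot_unimodular => //.
  apply/eqP; rewrite -(@pexpr_eq1 _ _ q) ?normc_ge0 // eq_le.
  by rewrite exprn_ile1 ?normc_ge0 //= -nzw ler_piMr
     ?exprn_ge0 ?exprn_ile1 ?normc_ge0.
apply/eqP; rewrite -(@pexpr_eq1 _ _ p) ?normc_ge0 // eq_le.
by rewrite exprn_ile1 ?normc_ge0 //= -nzw ler_piMl
     ?exprn_ge0 ?exprn_ile1 ?normc_ge0.
Qed.

End TorusKnot.

Theorem proposition6 (R : realType) (p q : nat)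
    (p_gt0 : (0 < p)%N) (q_gt0 : (0 < q)%N) (coprime_pq : gcdn p q = 1%N) :
  let K := torus_knot R p q in
  [/\ forall P : mpoly 2 R[i],
        peval P (cpair 0 0) = 1 -> sup_norm K P < 1 ->
        (p + q <= total_degree P)%N,
      poly_hull (p + q) K = K
    & forall d : nat, (d < p + q)%N -> K `<` poly_hull d K].
Proof.
have pq : coprime p q by rewrite /coprime coprime_pq.
split=> [P P1 PK||d d_lt].
- rewrite leqNgt; apply/negP => /(peval00_le_sup_norm p_gt0 pq).
  by rewrite P1 Normc.normc1 leNgt PK.
- rewrite eqEsubset; split; first exact: hull_in_knot.
  exact: torus_knot_sub_hull.
(* The origin witnesses strictness: it lies in the hull but not on the knot. *)
- split=> [|hull_sub]; first exact: torus_knot_sub_hull.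
  apply: (@origin_notin_knot R p q p_gt0); apply: hull_sub => P degP.
  exact: peval00_le_sup_norm (leq_ltn_trans degP d_lt).
Qed.
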